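(* For every integer $n \geq 2$, let $$s(n) = \log n - \max\left\{\log\left(\frac{e^{2+4/e}}{2^{5+4/e}}\left(\log \frac{n}{(\log n)^2}\right)^{3+4/e}\right),\ 2\log(\log n)\right\}.$$ Then for every integer $n \geq 2$, every real number $p \in (0,1)$ and every nontrivial monotone symmetric subset $A$ of $\{0,1\}^n$, $$\frac{d\mu_{p}(A)}{dp} \geq \frac{s(n)}{p(1-p)\,c_{\mathrm{LS}}(p)}\,\mu_{p}(A)\,(1-\mu_{p}(A)).$$
   Context: Here $\log$ is the natural logarithm. For $p\in[0,1]$, $\mu_p=\mu_{n,p}$ denotes the product Bernoulli probability measure on $\{0,1\}^n$: $\mu_{n,p}(x) = p^{\sum_{i=1}^n x_i}(1-p)^{\sum_{i=1}^n (1-x_i)}$. A subset $A\subset\{0,1\}^n$ is monotone if ($x\in A$ and $x\preceq y$) implies $y\in A$, where $\preceq$ is the coordinatewise partial order. $A$ is nontrivial if $A\neq\emptyset$ and $A\neq\{0,1\}^n$. $A$ is symmetric if there exists a subgroup $G$ of the symmetric group $\mathcal{S}_n$ acting transitively on $\{1,\ldots,n\}$ such that for all $g\in G$ and $x\in A$, $g\cdot x=(x_{g^{-1}(1)},\ldots,x_{g^{-1}(n)})\in A$. The function $c_{\mathrm{LS}}:(0,1)\to\mathbb{R}$ is defined by $c_{\mathrm{LS}}(p)=\dfrac{\log(1-p)-\log p}{(1-p)-p}$ if $p\neq \frac12$, and $c_{\mathrm{LS}}(\frac12)=2$. *)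

(* Defs.v *)
From HB Require Import structures.
From mathcomp Require Import all_boot all_order all_algebra all_fingroup.
From mathcomp Require Import reals topology normedtype sequences derive exp.

Set Implicit Arguments.
Unset Strict Implicit.
Unset Printing Implicit Defensive.

Import Order.TTheory GRing.Theory Num.Theory.
Import numFieldNormedType.Exports.
Local Open Scope ring_scope.

Notation cube n := {ffun 'I_n -> bool}.

(* This is the polynomial in p, for every real p; it is a probability measure
   only when p lies in [0, 1]. *)
Definition bernoulli_measure (R : realType) (n : nat) (p : R)
    (A : {set cube n}) : R :=
  \sum_(x in A)
    p ^+ (\sum_(i < n) x i)%N * (1 - p) ^+ (\sum_(i < n) (1 - x i))%N.

Definition monotone_set (n : nat) (A : {set cube n}) : Prop :=
  forall x y : cube n, x \in A -> (forall i, x i <= y i)%N -> y \in A.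

Definition nontrivial_set (n : nat) (A : {set cube n}) : Prop :=
  A <> set0 /\ A <> [set: cube n].

Definition perm_cube (n : nat) (g : 'S_n) (x : cube n) : cube n :=
  [ffun i => x ((g^-1)%g i)].

Definition symmetric_set (n : nat) (A : {set cube n}) : Prop :=
  exists G : {group 'S_n},
    [transitive G, on [set: 'I_n] | 'P] /\
    (forall (g : 'S_n) (x : cube n), g \in G -> x \in A -> perm_cube g x \in A).

Definition c_LS (R : realType) (p : R) : R :=
  if p == 1 / 2 then 2 else (ln (1 - p) - ln p) / ((1 - p) - p).

Definition s_rate (R : realType) (n : nat) : R :=
  let e : R := expR 1 in
  let N : R := n%:R in
  ln N -
  Num.max
    (ln (e `^ (2 + 4 / e) / 2 `^ (5 + 4 / e)
         * (ln (N / (ln N) ^+ 2)) `^ (3 + 4 / e)))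
    (2 * ln (ln N)).

(* Main.v *)
Require Import Defs.
From mathcomp Require Import all_boot all_order all_algebra all_fingroup.
From mathcomp Require Import reals topology normedtype sequences derive exp.
From mathcomp Require Import boolp classical_sets realfun ring lra.

Import Order.TTheory GRing.Theory Num.Theory.
Import numFieldNormedType.Exports.
Local Open Scope ring_scope.

(** Write f for the indicator of A, W = mu_p(A) (1 - mu_p(A)) for its variance
and I for the derivative of mu_p(A). By Russo's formula [russo], I is the sum
of the influences of the coordinates, and these are all equal to I / n because
a transitive group preserves A.

Decompose f - E f into martingale differences V_k, one for each coordinate, by
averaging the coordinates out one at a time, and apply to each V_k the
logarithmic Sobolev inequality [log_sobolev]
  Ent (V^2) <= c_LS(p) * sum_i E (V - E_i V)^2,
where E_i averages over coordinate i. Averaging operators commute, so the right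
hand sides add up to at most c_LS(p) p (1 - p) I. On the left, Jensen's
inequality gives Ent (V_k^2) >= w_k ln (w_k / (E |V_k|)^2) with w_k = E V_k^2;
here sum_k w_k = W, and E |V_k| <= 2 p (1 - p) I / n since averaging contracts
the L1 norm. This is the place where symmetry enters: each V_k is small in L1
but not in L2. By convexity the sum over k is smallest when all w_k are W / n
([falik_samorodnitsky]); with X = p (1 - p) I, W <= 1/4 and c_LS(p) >= 1,
the number t = c_LS(p) X / W satisfies
  ln n <= t + 2 ln t.
If t < ln n - 2 ln ln n, then t < ln n, hence t + 2 ln t < ln n, a
contradiction; so t >= s(n) ([s_rate_le]; n = 2 is checked numerically because
ln ln 2 < 0), which is the theorem.

The logarithmic Sobolev inequality on the cube follows from the one on two
points by subadditivity of entropy ([entropy_subadditive]). The two-point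
inequality with the sharp constant is, after normalisation, the statement that
x tanh x - ln cosh x is a concave function of 1 / cosh x, lying below its
tangent at the point x = ln ((1 - p) / p) / 2; the slope involved is
- x / sinh x, whose monotonicity is all that is needed
([tanh_profile_le]). *)

(** * Monotonicity of x / sinh x *)

Lemma is_derive_ndecr {R : realType} (f df : R -> R) (a b : R) :
  (forall x : R, is_derive x 1 f (df x)) ->
  (forall x, a < x -> x < b -> 0 <= df x) -> a <= b -> f a <= f b.
Proof.
move=> fdf df_ge0 leab.
have fc : {within `[a, b], continuous f}%classic.
  apply: continuous_subspaceT => x.
  by apply/differentiable_continuous/derivable1_diffP; case: (fdf x).
have fD (x : R) : derivable f x 1 by case: (fdf x).
have f'E (x : R) : derive1 f x = df x by rewrite derive1E; case: (fdf x).
apply: (ger0_derive1_ndecr (a := a) (b := b) _ _ fc) => // x.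
by rewrite in_itv /= f'E => /andP[ax xb]; exact: df_ge0.
Qed.

Definition sinh {R : realType} (x : R) : R := (expR x - expR (- x)) / 2.
Definition cosh {R : realType} (x : R) : R := (expR x + expR (- x)) / 2.

Lemma cosh_ge1 {R : realType} (x : R) : 1 <= cosh x.
Proof.
have := expR_ge1Dx x; have := expR_ge1Dx (- x); rewrite /cosh.
lra.
Qed.

Lemma cosh_gt0 {R : realType} (x : R) : 0 < cosh x.
Proof. exact: lt_le_trans ltr01 (cosh_ge1 x). Qed.

Lemma coshN {R : realType} (x : R) : cosh (- x) = cosh x.
Proof. by rewrite /cosh opprK addrC. Qed.

Lemma sinhN {R : realType} (x : R) : sinh (- x) = - sinh x.
Proof. by rewrite /sinh opprK -mulNr opprB. Qed.

Lemma sinh0 {R : realType} : sinh 0 = 0 :> R.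
Proof. by rewrite /sinh oppr0 subrr mul0r. Qed.

Lemma cosh2_sinh2 {R : realType} (x : R) : cosh x ^+ 2 - sinh x ^+ 2 = 1.
Proof. by rewrite -(expRxMexpNx_1 x) /cosh /sinh; field. Qed.

Global Instance is_derive_sinh {R : realType} (x : R) :
  is_derive x 1 sinh (cosh x).
Proof.
rewrite /sinh; apply: is_derive_eq.
by rewrite /cosh; rewrite !scaler0 add0r /GRing.scale /=; lra.
Qed.

Global Instance is_derive_cosh {R : realType} (x : R) :
  is_derive x 1 cosh (sinh x).
Proof.
rewrite /cosh; apply: is_derive_eq.
by rewrite /sinh; rewrite !scaler0 add0r /GRing.scale /=; lra.
Qed.

Lemma sinh_ge0 {R : realType} (x : R) : 0 <= x -> 0 <= sinh x.
Proof.
move=> x0; rewrite -[X in X <= _](@sinh0 R).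
by apply: (@is_derive_ndecr _ _ cosh) => // z _ _; exact/ltW/cosh_gt0.
Qed.

Lemma ge_sinh {R : realType} (x : R) : 0 <= x -> x <= sinh x.
Proof.
move=> x0; rewrite -subr_ge0.
have -> : 0 = (fun z : R => sinh z - z) 0 by rewrite /= sinh0 subr0.
apply: (@is_derive_ndecr _ (fun z : R => sinh z - z) (fun z => cosh z - 1)) => //.
by move=> z _ _; rewrite subr_ge0 cosh_ge1.
Qed.

Lemma le_sinh_cosh {R : realType} (x : R) : 0 <= x -> sinh x <= x * cosh x.
Proof.
move=> x0; rewrite -subr_ge0.
pose f (z : R) := z * cosh z - sinh z.
have -> : 0 = f 0 by rewrite /f sinh0 subr0 mul0r.
apply: (@is_derive_ndecr _ f (fun z => z * sinh z)) => //.
  move=> z; rewrite /f; apply: is_derive_eq.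
  by rewrite /GRing.scale /=; lra.
by move=> z z0 _; rewrite mulr_ge0 ?sinh_ge0 // ltW.
Qed.

(** This is the monotonicity of sinh x / x, multiplied out so that x = 0 is
covered. *)
Lemma sinh_div_ndecr {R : realType} (x y : R) :
  0 <= x -> x <= y -> y * sinh x <= x * sinh y.
Proof.
move=> x0 xy; rewrite -subr_ge0.
pose f (z : R) := x * sinh z - z * sinh x.
have <- : f x = 0 by rewrite /f subrr.
apply: (@is_derive_ndecr _ f (fun z => x * cosh z - sinh x)) => //.
  move=> z; rewrite /f; apply: is_derive_eq.
  by rewrite !scaler0 /GRing.scale /=; lra.
move=> z xz _; rewrite subr_ge0; apply: (le_trans (le_sinh_cosh _ x0)).
rewrite ler_wpM2l //; apply: (@is_derive_ndecr _ _ sinh _ _ _ _ (ltW xz)).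
by move=> u xu _; rewrite sinh_ge0 // ltW // (le_lt_trans x0).
Qed.

(** * The sharp two-point logarithmic Sobolev inequality *)

(** For the probability vector (s, 1 - s) with log-odds 2 x, the relative entropy to
the uniform measure is x tanh x - ln cosh x, and 2 sqrt (s (1 - s)), to which the
cross term of the energy is proportional, is 1 / cosh x; K is its weight. *)
Definition tanh_profile {R : realType} (K x : R) : R :=
  x * (sinh x / cosh x) - ln (cosh x) + K / cosh x.

Lemma is_derive_tanh_profile {R : realType} (K x : R) :
  is_derive x 1 (tanh_profile K) ((x - K * sinh x) / cosh x ^+ 2).
Proof.
have c0 : cosh x != 0 by rewrite gt_eqF // cosh_gt0.
have dV := is_deriveV c0 (is_derive_cosh x).
have dln : is_derive x 1 (fun z : R => ln (cosh z)) ((cosh x)^-1 * sinh x).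
  exact: (is_derive1_comp (is_derive1_ln (cosh_gt0 x)) (is_derive_cosh x)).
rewrite /tanh_profile; apply: is_derive_eq.
transitivity ((x * (cosh x ^+ 2 - sinh x ^+ 2) - K * sinh x) / cosh x ^+ 2).
  by rewrite /GRing.scale /=; field.
by rewrite cosh2_sinh2 mulr1.
Qed.

(** The profile is even, and for x > 0 its derivative has the sign of x / sinh x - K.
The hypotheses say that K is the value of x / sinh x at y, extended by 1 at 0. As
x / sinh x decreases on the positive half-line, the profile increases up to y and
decreases after it. *)
Lemma tanh_profile_le {R : realType} (K x y : R) :
  0 <= y -> K * sinh y = y -> (y = 0 -> K = 1) ->
  tanh_profile K x <= tanh_profile K y.
Proof.
move=> y0 Ky K1.
wlog x0 : x / 0 <= x.
  move=> H; have [|/ltW xN] := leP 0 x; first exact: H.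
  have -> : tanh_profile K x = tanh_profile K (- x).
    by rewrite /tanh_profile coshN sinhN !mulNr mulrN opprK.
  by apply: H; rewrite oppr_ge0.
pose G' (z : R) := (z - K * sinh z) / cosh z ^+ 2.
have GD := is_derive_tanh_profile K.
have chV z : 0 <= (cosh z ^+ 2)^-1 :> R.
  by rewrite invr_ge0 exprn_ge0 // ltW // cosh_gt0.
have [xy|/ltW yx] := leP x y.
- apply: (@is_derive_ndecr _ _ G' _ _ GD) => // z xz zy.
  rewrite mulr_ge0 // subr_ge0.
  have yp : 0 < y by apply: le_lt_trans zy; apply: (le_trans x0); exact: ltW.
  have sp : 0 < sinh y by apply: (lt_le_trans yp); exact: ge_sinh.
  rewrite -(ler_pM2r sp) mulrAC Ky.
  by apply: sinh_div_ndecr; [exact: (le_trans x0 (ltW xz))|exact: ltW].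
- rewrite -lerN2.
  have GDN (z : R) : is_derive z 1 (fun z => - tanh_profile K z)
      (- ((z - K * sinh z) / cosh z ^+ 2)).
    exact: is_deriveN (GD z).
  apply: (@is_derive_ndecr _ _ (fun z => - G' z) _ _ GDN) => // z yz _.
  rewrite -mulNr mulr_ge0 // opprB subr_ge0.
  have [y_eq0|yn0] := eqVneq y 0.
    by rewrite K1 // mul1r ge_sinh // -y_eq0 ltW.
  have yp : 0 < y by rewrite lt_def yn0.
  have sp : 0 < sinh y by apply: (lt_le_trans yp); exact: ge_sinh.
  rewrite -(ler_pM2r sp) mulrAC Ky.
  by apply: sinh_div_ndecr => //; exact: ltW.
Qed.

Definition xlnx {R : realType} (u : R) : R := u * ln u.

Lemma c_LS_mul {R : realType} (p : R) :
  c_LS p * (1 - p - p) = ln (1 - p) - ln p.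
Proof.
rewrite /c_LS; have [->|pn] := eqVneq p (1 / 2).
  by have -> : 1 - 1 / 2 = 1 / 2 :> R by [lra]; rewrite !subrr mulr0.
rewrite divfK //; apply: contra pn => /eqP e; apply/eqP; lra.
Qed.

Lemma c_LS_onem {R : realType} (p : R) : c_LS (1 - p) = c_LS p.
Proof.
rewrite /c_LS; have -> : 1 - (1 - p) = p by lra.
have [->|pn] := eqVneq p (1 / 2).
  by have -> : 1 - 1 / 2 = 1 / 2 :> R by [lra]; rewrite eqxx.
rewrite ifN; last by apply: contra pn => /eqP e; apply/eqP; lra.
by rewrite -[in RHS]opprB -[X in _ = _ / X]opprB invrN mulrNN.
Qed.

(** From 1 - 1/u <= ln u at u = (1 - p) / p. *)
Lemma c_LS_ge1 {R : realType} (p : R) : 0 < p -> p < 1 -> 1 <= c_LS p.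
Proof.
wlog p2 : p / p <= 1 / 2.
  move=> H p0 p1; have [|p2] := leP p (1 / 2); first by move=> ?; exact: H.
  by rewrite -c_LS_onem; apply: H; lra.
move=> p0 p1; have [->|pn] := eqVneq p (1 / 2).
  by rewrite /c_LS eqxx; lra.
have pl : p < 1 / 2 by rewrite lt_neqAle pn.
have d0 : 0 < 1 - p - p by lra.
rewrite -(ler_pM2r d0) mul1r c_LS_mul -ln_div ?posrE //; last by lra.
have := @le_ln1Dx R (p / (1 - p) - 1).
have q0 : 0 < 1 - p by lra.
rewrite subrKC [ln (p / _)]ln_div ?posrE // => H.
have : ln p - ln (1 - p) <= p / (1 - p) - 1.
  by apply: H; rewrite ltrBrDr addNr divr_gt0.
have e : p / (1 - p) - 1 = - (1 - p - p) / (1 - p) by field; lra.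
rewrite ln_div ?posrE // e mulNr.
have : 1 - p - p <= (1 - p - p) / (1 - p) by rewrite ler_pdivlMr //; nra.
lra.
Qed.

(** Let x be half the log-odds ln (p b^2 / ((1 - p) a^2)) and y half of
ln ((1 - p) / p); equality holds at x = y and at x = - y, which is a = b. The
maximality of the profile at y, multiplied by M = (1 - p) a^2 + p b^2, is
the inequality, with K = sqrt (p (1 - p)) c_LS(p): the identity
c_LS(p) (1 - 2 p) = 2 y gives K sinh y = y, and it makes the coefficients of a^2
and b^2 agree. *)
Lemma two_point_log_sobolev_pos {R : realType} (p a b : R) :
  0 < p -> p <= 1 / 2 -> 0 < a -> 0 < b ->
  (1 - p) * xlnx (a ^+ 2) + p * xlnx (b ^+ 2)
    - xlnx ((1 - p) * a ^+ 2 + p * b ^+ 2)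
  <= c_LS p * (p * (1 - p)) * (a - b) ^+ 2.
Proof.
move=> p0 p2 a0 b0.
have q0 : 0 < 1 - p by lra.
(* The square roots of p and 1 - p. *)
pose P : R := expR (ln p / 2); pose Q : R := expR (ln (1 - p) / 2).
have P0 : 0 < P by exact: expR_gt0.
have Q0 : 0 < Q by exact: expR_gt0.
have P2 : P ^+ 2 = p by rewrite /P -expRM_natr divfK ?pnatr_eq0 ?lnK ?posrE.
have Q2 : Q ^+ 2 = 1 - p by rewrite /Q -expRM_natr divfK ?pnatr_eq0 ?lnK ?posrE.
have PQ2 : (P * Q) ^+ 2 = p * (1 - p) by rewrite exprMn P2 Q2.
pose c := c_LS p; have cE : c * (1 - p - p) = ln (1 - p) - ln p := c_LS_mul p.
pose y := (ln (1 - p) - ln p) / 2; pose x := ln b - ln a - y.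
pose M := (1 - p) * a ^+ 2 + p * b ^+ 2.
have M0 : 0 < M by rewrite addr_gt0 // mulr_gt0 // exprn_gt0.
have ey : expR y = Q / P by rewrite /y mulrBl expRB.
have eNy : expR (- y) = P / Q by rewrite expRN ey invf_div.
have ex : expR x = b * P / (a * Q).
  rewrite /x expRB expRB !lnK ?posrE // ey; field.
  by rewrite !gt_eqF.
have eNx : expR (- x) = a * Q / (b * P) by rewrite expRN ex invf_div.
have chy : cosh y = (2 * (P * Q))^-1.
  rewrite /cosh ey eNy; have : P ^+ 2 + Q ^+ 2 = 1 by rewrite P2 Q2; lra.
  move=> e; rewrite -[RHS]mul1r -e; field.
  by rewrite e oner_eq0 !gt_eqF.
have shy : sinh y = (1 - p - p) / (2 * (P * Q)).
  have -> : 1 - p - p = Q ^+ 2 - P ^+ 2 by rewrite P2 Q2.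
  by rewrite /sinh ey eNy; field; rewrite !gt_eqF.
have chx : cosh x = M / (2 * (a * b * (P * Q))).
  have -> : M = Q ^+ 2 * a ^+ 2 + P ^+ 2 * b ^+ 2 by rewrite P2 Q2.
  by rewrite /cosh ex eNx; field; rewrite !gt_eqF.
have shx : sinh x = (p * b ^+ 2 - (1 - p) * a ^+ 2) / (2 * (a * b * (P * Q))).
  rewrite -[X in (_ - X * _) / _]Q2 -[X in (X * _ - _) / _]P2.
  by rewrite /sinh ex eNx; field; rewrite !gt_eqF.
have y0 : 0 <= y.
  rewrite /y divr_ge0 // subr_ge0 ler_ln ?posrE //; lra.
have Ky : P * Q * c * sinh y = y.
  by rewrite shy /y -cE; field; rewrite !gt_eqF.
have K1 : y = 0 -> P * Q * c = 1.
  move=> yE; have e2 : p = 1 - p.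
    by apply: ln_inj; rewrite ?posrE //; move: yE; rewrite /y; lra.
  have eP : Q = P by rewrite /Q -e2.
  rewrite eP -expr2 P2 /c /c_LS; have -> : p = 1 / 2 by [lra].
  by rewrite eqxx; lra.
have lPQ : ln (P * Q) = (ln p + ln (1 - p)) / 2.
  by rewrite lnM ?posrE // /P /Q !expRK; lra.
have lcx : ln (cosh x) = ln M - (ln 2 + (ln a + ln b + ln (P * Q))).
  by rewrite chx ln_div ?posrE ?mulr_gt0 // !lnM ?posrE ?mulr_gt0.
have lcy : ln (cosh y) = - (ln 2 + ln (P * Q)).
  by rewrite chy lnV ?posrE ?mulr_gt0 // lnM ?posrE ?mulr_gt0.
have Mn0 : M != 0 by rewrite gt_eqF.
have tx : sinh x / cosh x = (p * b ^+ 2 - (1 - p) * a ^+ 2) / M.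
  by rewrite shx chx; field; rewrite !gt_eqF.
have ty : sinh y / cosh y = 1 - p - p.
  by rewrite shy chy; field; rewrite !gt_eqF.
have Kx : P * Q * c / cosh x = 2 * c * (p * (1 - p)) * (a * b) / M.
  by rewrite -PQ2 chx; field; rewrite !gt_eqF.
have Ky2 : P * Q * c / cosh y = 2 * c * (p * (1 - p)).
  by rewrite -PQ2 chy; field; rewrite !gt_eqF.
have := tanh_profile_le (P * Q * c) x y y0 Ky K1.
rewrite /tanh_profile tx ty Kx Ky2 lcx lcy -(ler_pM2r M0).
have lhsE u v l : (x * (u / M) - l + v / M) * M = x * u - l * M + v.
  by field.
rewrite lhsE /xlnx -/M !lnXn // /x /y -cE -/c.
(* Both sides now differ by a polynomial identity in which the logarithms are
   mere variables. *)
move: (ln a) (ln b) (ln M) (ln 2) (ln (P * Q)) => la lb lM l2 lPQ_.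
rewrite -subr_ge0 => H; rewrite -subr_ge0; move: H.
by rewrite /M; congr (_ <= _); field.
Qed.

Lemma ln_le_tangent {R : realType} (x y : R) :
  0 < x -> 0 < y -> ln x <= ln y + x / y - 1.
Proof.
move=> x0 y0; have := @le_ln1Dx R (x / y - 1).
rewrite subrKC ln_div ?posrE // ltrBrDr addNr divr_gt0 // => /(_ isT); lra.
Qed.

(** Concavity of ln: 1 - p is the combination of p and 1 with weights p / (1 - p)
and (1 - 2 p) / (1 - p), and ln 1 = 0. *)
Lemma xlnx_le_onem {R : realType} (p : R) :
  0 < p -> p <= 1 / 2 -> xlnx p <= xlnx (1 - p).
Proof.
move=> p0 p2; have q0 : 0 < 1 - p by lra.
have H1 := ln_le_tangent p (1 - p) p0 q0.
have H2 := ln_le_tangent 1 (1 - p) ltr01 q0.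
rewrite ln1 in H2; rewrite /xlnx.
have e1 : p * (ln (1 - p) + p / (1 - p) - 1)
  + (1 - p - p) * (ln (1 - p) + 1 / (1 - p) - 1) = (1 - p) * ln (1 - p).
  by field; rewrite gt_eqF.
have : p * ln p <= p * (ln (1 - p) + p / (1 - p) - 1) by rewrite ler_pM2l.
have : 0 <= (1 - p - p) * (ln (1 - p) + 1 / (1 - p) - 1).
  by rewrite mulr_ge0 //; lra.
lra.
Qed.

(** The two-point inequality for functions vanishing at one of the points, which
the log-odds parametrisation does not reach. *)
Lemma neg_ln_le_c_LS {R : realType} (p : R) :
  0 < p -> p <= 1 / 2 ->
  - ln p <= c_LS p * (1 - p) /\ - ln (1 - p) <= c_LS p * p.
Proof.
move=> p0 p2; have cE := c_LS_mul p.
have := xlnx_le_onem p p0 p2; rewrite /xlnx => lnp.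
have [pE|pn] := eqVneq p (1 / 2).
  have -> : 1 - p = p by lra.
  have : ln (2 : R) <= 1 by have := ln_le_tangent (2 : R) 1; rewrite ln1; lra.
  rewrite /c_LS pE eqxx div1r lnV ?posrE //; lra.
have d0 : 0 < 1 - p - p by rewrite !subr_gt0; lra.
by split; rewrite -(ler_pM2r d0) mulrAC cE; lra.
Qed.

(** Passing to absolute values keeps the squares and shrinks the difference, so
nonnegative a and b suffice; exchanging the two points reduces to p <= 1/2. *)
Lemma two_point_log_sobolev {R : realType} (p a b : R) :
  0 < p -> p < 1 ->
  (1 - p) * xlnx (a ^+ 2) + p * xlnx (b ^+ 2)
    - xlnx ((1 - p) * a ^+ 2 + p * b ^+ 2)
  <= c_LS p * (p * (1 - p)) * (a - b) ^+ 2.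
Proof.
wlog p2 : p a b / p <= 1 / 2.
  move=> H p0 p1; have [|p2] := leP p (1 / 2); first by move=> ?; exact: H.
  have e : 1 - (1 - p) = p by lra.
  have := H (1 - p) b a; rewrite c_LS_onem e.
  rewrite [p * _ + _]addrC [p * (b ^+ 2) + _]addrC [(1 - p) * p]mulrC.
  by rewrite -[(b - a) ^+ 2]sqrrN opprB; apply; lra.
move=> p0 p1; have q0 : 0 < 1 - p by lra.
wlog /andP[a0 b0] : a b / (0 <= a) && (0 <= b).
  move=> H; have := H `|a| `|b|; rewrite !normr_ge0 => /(_ isT).
  rewrite !real_normK ?num_real // => /le_trans; apply.
  rewrite ler_wpM2l //; last first.
    rewrite -[leLHS]real_normK ?num_real // -[leRHS]real_normK ?num_real //.
    by rewrite ler_sqr ?nnegrE // ler_dist_dist.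
  by rewrite !mulr_ge0 ?(ltW p0) ?(ltW q0) // (le_trans ler01) // c_LS_ge1.
have [lp lq] := neg_ln_le_c_LS p p0 p2.
have xlnxM (u w : R) : 0 < u -> 0 < w ->
    u * xlnx (w ^+ 2) - xlnx (u * w ^+ 2) = u * w ^+ 2 * - ln u.
  move=> u0 w0; rewrite /xlnx lnM ?posrE ?exprn_gt0 //; ring.
have xlnx0 : xlnx (0 : R) = 0 by rewrite /xlnx mul0r.
have [->|an] := eqVneq a 0; have [->|bn] := eqVneq b 0.
- by rewrite subrr expr0n /= !mulr0 addr0 xlnx0 !mulr0 addr0 subrr.
- have bp : 0 < b by rewrite lt_def bn.
  rewrite expr0n /= mulr0 xlnx0 mulr0 !add0r xlnxM // sqrrN.
  have -> : c_LS p * (p * (1 - p)) * b ^+ 2 = p * b ^+ 2 * (c_LS p * (1 - p)).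
    by ring.
  by rewrite ler_wpM2l // mulr_ge0 ?sqr_ge0 // ltW.
- have ap : 0 < a by rewrite lt_def an.
  rewrite expr0n /= mulr0 xlnx0 mulr0 !addr0 xlnxM // subr0.
  have -> : c_LS p * (p * (1 - p)) * a ^+ 2 = (1 - p) * a ^+ 2 * (c_LS p * p).
    by ring.
  by rewrite ler_wpM2l // mulr_ge0 ?sqr_ge0 // ltW.
- by apply: two_point_log_sobolev_pos; rewrite // lt_def ?an ?bn.
Qed.

(** * Product Bernoulli expectation and averaging operators *)

Section Cube.
Context {R : realType} {n : nat}.
Implicit Types (p : R) (i j : 'I_n) (x : cube n) (f g h : cube n -> R).

Definition set_coord i (b : bool) x : cube n :=
  [ffun j => if j == i then b else x j].

Lemma set_coord_id i x : set_coord i (x i) x = x.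
Proof. by apply/ffunP => j; rewrite ffunE; case: eqP => [->|]. Qed.

Lemma set_coord_set i b c x : set_coord i b (set_coord i c x) = set_coord i b x.
Proof. by apply/ffunP => j; rewrite !ffunE; case: eqP. Qed.

Lemma set_coordC i j b c x : i != j ->
  set_coord i b (set_coord j c x) = set_coord j c (set_coord i b x).
Proof.
move=> ij; apply/ffunP => k; rewrite !ffunE.
by case: (eqVneq k i) => [->|//]; rewrite (negPf ij).
Qed.

Definition weight p x : R :=
  p ^+ (\sum_(i < n) x i)%N * (1 - p) ^+ (\sum_(i < n) (1 - x i))%N.

Lemma weightE p x : weight p x = \prod_i (if x i then p else 1 - p).
Proof.
rewrite /weight !expr_sum -big_split /=; apply: eq_bigr => i _.
by case: (x i); rewrite ?expr0 ?expr1 ?mulr1 ?mul1r.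
Qed.

Lemma weight_gt0 p x : 0 < p -> p < 1 -> 0 < weight p x.
Proof. by move=> p0 p1; rewrite mulr_gt0 ?exprn_gt0 ?subr_gt0. Qed.

Lemma sum_weight p : \sum_x weight p x = 1.
Proof.
under eq_bigr do rewrite weightE.
rewrite -(bigA_distr_bigA (fun (i : 'I_n) (b : bool) => if b then p else 1 - p)).
by apply: big1 => i _; rewrite big_bool /= subrKC.
Qed.

Lemma weight_set_coord p i x : exists r : R,
  forall b, weight p (set_coord i b x) = (if b then p else 1 - p) * r.
Proof.
exists (\prod_(j | j != i) (if x j then p else 1 - p)) => b.
rewrite weightE (bigD1 i) //= ffunE eqxx; congr (_ * _).
by apply: eq_bigr => j ji; rewrite ffunE (negPf ji).
Qed.

Definition expect p f : R := \sum_x weight p x * f x.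

Lemma bernoulli_measureE p (A : {set cube n}) :
  bernoulli_measure p A = expect p (fun x => (x \in A)%:R).
Proof.
rewrite /bernoulli_measure /expect big_mkcond; apply: eq_bigr => x _.
by case: (x \in A); rewrite ?mulr1 ?mulr0.
Qed.

Lemma expect_cst p (c : R) : expect p (fun=> c) = c.
Proof. by rewrite /expect -mulr_suml sum_weight mul1r. Qed.

Lemma eq_expect p f g : f =1 g -> expect p f = expect p g.
Proof. by move=> fg; apply: eq_bigr => x _; rewrite fg. Qed.

Lemma expectD p f g : expect p (fun x => f x + g x) = expect p f + expect p g.
Proof. by rewrite /expect -big_split; apply: eq_bigr => x _; rewrite mulrDr. Qed.

Lemma expectB p f g : expect p (fun x => f x - g x) = expect p f - expect p g.
Proof. by rewrite /expect -sumrB; apply: eq_bigr => x _; rewrite mulrBr. Qed.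

Lemma expectZ p (c : R) f : expect p (fun x => c * f x) = c * expect p f.
Proof. by rewrite /expect mulr_sumr; apply: eq_bigr => x _; rewrite mulrCA. Qed.

Lemma le_expect p f g : 0 < p -> p < 1 ->
  (forall x, f x <= g x) -> expect p f <= expect p g.
Proof.
by move=> p0 p1 fg; apply: ler_sum => x _; rewrite ler_wpM2l // ltW // weight_gt0.
Qed.

Lemma expect_ge0 p f : 0 < p -> p < 1 ->
  (forall x, 0 <= f x) -> 0 <= expect p f.
Proof. by move=> p0 p1 f0; rewrite -(expect_cst p 0) le_expect. Qed.

Definition cond_exp p i f : cube n -> R := fun x =>
  (1 - p) * f (set_coord i false x) + p * f (set_coord i true x).

(** Pair each point of the cube with its neighbour in direction i. *)
Lemma sum_set_coord i f :
  \sum_x f x *+ 2 = \sum_x (f (set_coord i false x) + f (set_coord i true x)).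
Proof.
pose flip x := set_coord i (~~ x i) x.
have flipK : involutive flip.
  move=> x; rewrite /flip set_coord_set [in ~~ _]/set_coord ffunE eqxx negbK.
  exact: set_coord_id.
rewrite sumrMnl mulr2n {2}(reindex_inj (inv_inj flipK)) -big_split /=.
apply: eq_bigr => x _; rewrite /flip -{1}(set_coord_id i x).
by case: (x i); rewrite //= addrC.
Qed.

Lemma expect_cond_exp p i f : expect p (cond_exp p i f) = expect p f.
Proof.
suff: expect p (cond_exp p i f) *+ 2 = expect p f *+ 2 by lra.
rewrite /expect -!sumrMnl !(sum_set_coord i).
apply: eq_bigr => x _; have [r wE] := weight_set_coord p i x.
by rewrite /cond_exp !wE !set_coord_set; ring.
Qed.

Definition insensitive i h := forall b x, h (set_coord i b x) = h x.

Lemma insensitive_cond_exp p i f : insensitive i (cond_exp p i f).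
Proof. by move=> b x; rewrite /cond_exp !set_coord_set. Qed.

Lemma cond_expC p i j f :
  cond_exp p i (cond_exp p j f) = cond_exp p j (cond_exp p i f).
Proof.
have [-> //|ij] := eqVneq i j; apply/funext => x; rewrite /cond_exp.
by rewrite !(set_coordC j i) 1?eq_sym //; ring.
Qed.

Lemma expectM_insensitive p i f h : insensitive i h ->
  expect p (fun x => f x * h x) = expect p (fun x => cond_exp p i f x * h x).
Proof.
move=> hi; rewrite -(expect_cond_exp p i); apply: eq_expect => x.
by rewrite /cond_exp !hi; ring.
Qed.

(** The part of f that depends on coordinate i; it is used instead of a
difference quotient because it commutes with all averaging operators. *)
Definition lap p i f : cube n -> R := fun x => f x - cond_exp p i f x.

(** Pythagoras: averaging over a coordinate is an orthogonal projection. *)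
Lemma expect_sqr_lap p i f : 
  expect p (fun x => lap p i f x ^+ 2) 
  = expect p (fun x => f x ^+ 2) - expect p (fun x => cond_exp p i f x ^+ 2).
Proof.
have e : expect p (fun x => f x * cond_exp p i f x)
    = expect p (fun x => cond_exp p i f x ^+ 2).
  by rewrite (expectM_insensitive _ i) //; exact: insensitive_cond_exp.
rewrite -[LHS](addrK (expect p (fun x => cond_exp p i f x ^+ 2) *+ 2)).
rewrite -{1}e -mulr_natl -expectZ -expectD.
rewrite (eq_expect _ _ (fun x => f x ^+ 2 + cond_exp p i f x ^+ 2)).
  by rewrite expectD; ring.
by move=> x; rewrite /lap; ring.
Qed.

Lemma expect_sqr_lap_diff p i f :
  expect p (fun x => lap p i f x ^+ 2) = p * (1 - p) *
    expect p (fun x => (f (set_coord i false x) - f (set_coord i true x)) ^+ 2).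
Proof.
rewrite -(expect_cond_exp p i) -expectZ; apply: eq_expect => x.
by rewrite /lap /cond_exp !set_coord_set; ring.
Qed.

(** Averages over the coordinates in s, so that along the suffixes of a
list of coordinates these form a martingale. *)
Definition avg p (s : seq 'I_n) f : cube n -> R := foldr (cond_exp p) f s.

Lemma avg_cond_exp p i s f :
  avg p s (cond_exp p i f) = cond_exp p i (avg p s f).
Proof. by elim: s => //= j s ->; rewrite cond_expC. Qed.

Lemma avg_lap p i s f : avg p s (lap p i f) = lap p i (avg p s f).
Proof.
rewrite {2}/lap -avg_cond_exp; elim: s => //= j s ->.
by apply/funext => x; rewrite /cond_exp; ring.
Qed.

Lemma lapC p i j f : lap p i (lap p j f) = lap p j (lap p i f).
Proof.
apply/funext => x; rewrite [RHS]/lap.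
have /= -> := avg_lap p i [:: j] f.
by rewrite /lap /cond_exp; ring.
Qed.

Lemma expect_avg p s f : expect p (avg p s f) = expect p f.
Proof. by elim: s => //= i s IHs; rewrite expect_cond_exp. Qed.

(** After every coordinate is averaged out, no coordinate matters: the result is
a constant with the same expectation. *)
Lemma avg_enum p f x : avg p (enum 'I_n) f x = expect p f.
Proof.
have ins i : insensitive i (avg p (enum 'I_n) f).
  have: i \in enum 'I_n by rewrite mem_enum.
  elim: (enum _) => //= j s IHs; rewrite inE.
  case/predU1P => [->|/IHs his]; first exact: insensitive_cond_exp.
  have [->|ij] := eqVneq i j; first exact: insensitive_cond_exp.
  by move=> b y; rewrite /cond_exp !(set_coordC j i) 1?eq_sym // !his.
suff cstA y : avg p (enum 'I_n) f y = avg p (enum 'I_n) f x.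
  by rewrite -[RHS](expect_avg _ (enum 'I_n)) (eq_expect _ _ _ cstA) expect_cst.
(* Interpolate between y and x, switching the coordinates in s from y to x. *)
pose mix (s : seq 'I_n) : cube n := [ffun j => if j \in s then x j else y j].
have mixE s : avg p (enum 'I_n) f (mix s) = avg p (enum 'I_n) f y.
  elim: s => [|j s <-].
    by congr (avg _ _ _ _); apply/ffunP => k; rewrite ffunE.
  rewrite -[RHS](ins j (x j)); congr (avg _ _ _ _); apply/ffunP => k.
  by rewrite !ffunE inE; case: (eqVneq k j) => [->|].
rewrite -(mixE (enum 'I_n)); congr (avg _ _ _ _); apply/ffunP => k.
by rewrite ffunE mem_enum.
Qed.

Lemma avg_ge0 p s f : 0 < p -> p < 1 ->
  (forall x, 0 <= f x) -> forall x, 0 <= avg p s f x.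
Proof.
move=> p0 p1 f0; elim: s => //= i s IHs x.
by rewrite addr_ge0 // mulr_ge0 // ?subr_ge0 ltW.
Qed.

Lemma avg_gt0 p s f x : 0 < p -> p < 1 ->
  (forall y, 0 <= f y) -> 0 < f x -> 0 < avg p s f x.
Proof.
move=> p0 p1 f0 fx; have A0 s' := avg_ge0 p s' f p0 p1 f0.
have q0 : 0 < 1 - p by rewrite subr_gt0.
elim: s => //= i s; rewrite -{1}(set_coord_id i x) /cond_exp.
by case: (x i) => H; [apply: ltr_wpDl|apply: ltr_wpDr];
  rewrite ?(mulr_gt0, mulr_ge0) // ltW.
Qed.

Lemma expect_norm_avg p s f : 0 < p -> p < 1 ->
  expect p (fun x => `|avg p s f x|) <= expect p (fun x => `|f x|).
Proof.
move=> p0 p1; rewrite -[leRHS](expect_avg p s); apply: le_expect => //.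
elim: s => //= i s IHs x; rewrite /cond_exp.
apply: le_trans (ler_normD _ _) _.
by apply: lerD; rewrite normrM gtr0_norm ?subr_gt0 // ler_pM2l // subr_gt0.
Qed.

End Cube.

(** * Entropy on the cube *)

(** This is ln u <= u - 1 at u = M A / (F a), in a form that survives a = 0. *)
Lemma mul_ln_ratio_le {R : realType} (a A F M : R) :
  0 <= a -> 0 <= A -> 0 <= F -> 0 <= M ->
  (0 < a -> [/\ 0 < A, 0 < F & 0 < M]) ->
  a * (ln A - ln F) <= xlnx a - a * ln M + (M * A / F - a).
Proof.
rewrite le0r => /predU1P[-> A0 F0 M0 _|a0 _ _ _ /(_ a0)[A0 F0 M0]].
  by rewrite /xlnx !mul0r !subr0 add0r divr_ge0 ?mulr_ge0.
have x0 : 0 < M * A / (F * a) by rewrite divr_gt0 ?mulr_gt0.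
have := ln_le_tangent _ 1 x0 ltr01; rewrite ln1 add0r divr1.
rewrite ln_div ?lnM ?posrE ?mulr_gt0 // -(ler_pM2l a0) => H.
have e : a * (M * A / (F * a) - 1) = M * A / F - a by field; rewrite !gt_eqF.
by rewrite -e /xlnx; lra.
Qed.

(** The variational formula for entropy on two points: testing (a, b) against the
logarithm of a density, here (A / F, B / F), gives at most its entropy. The
hypotheses make the terms with ln 0 disappear. *)
Lemma two_point_entropy_dual {R : realType} (p a b A B F : R) :
  0 < p -> p < 1 -> 0 <= a -> 0 <= b -> 0 <= A -> 0 <= B ->
  (0 < a -> 0 < A) -> (0 < b -> 0 < B) -> F = (1 - p) * A + p * B ->
  (1 - p) * (a * (ln A - ln F)) + p * (b * (ln B - ln F))
  <= (1 - p) * xlnx a + p * xlnx b - xlnx ((1 - p) * a + p * b).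
Proof.
move=> p0 p1 a0 b0 A0 B0 aA bB FE; pose M := (1 - p) * a + p * b.
have q0 : 0 < 1 - p by rewrite subr_gt0.
have F0 : 0 <= F by rewrite FE addr_ge0 // mulr_ge0 // ltW.
have M0 : 0 <= M by rewrite addr_ge0 // mulr_ge0 // ltW.
have Ha : a * (ln A - ln F) <= xlnx a - a * ln M + (M * A / F - a).
  apply: mul_ln_ratio_le => // ap; have Ap := aA ap.
  by split=> //; rewrite ?FE; apply: ltr_wpDr; rewrite ?mulr_gt0 // mulr_ge0 // ltW.
have Hb : b * (ln B - ln F) <= xlnx b - b * ln M + (M * B / F - b).
  apply: mul_ln_ratio_le => // bp; have Bp := bB bp.
  by split=> //; rewrite ?FE; apply: ltr_wpDl; rewrite ?mulr_gt0 // mulr_ge0 // ltW.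
have : M * F / F <= M.
  by have [->|Fn] := eqVneq F 0; [rewrite mulr0 mul0r|rewrite mulfK].
have -> : M * F / F = (1 - p) * (M * A / F) + p * (M * B / F).
  by rewrite {1}FE; ring.
move: (ler_wpM2l (ltW q0) Ha) (ler_wpM2l (ltW p0) Hb).
rewrite [xlnx (_ + _)]/xlnx -/M; move: (M * A / F) (M * B / F) => u v.
move: (ln M) (ln A - ln F) (ln B - ln F) => lM lA lB; rewrite /M; lra.
Qed.

Section Entropy.
Context {R : realType} {n : nat}.
Implicit Types (p : R) (i j : 'I_n) (x : cube n) (f g h : cube n -> R).

Definition entropy p g : R :=
  expect p (fun x => xlnx (g x)) - xlnx (expect p g).

Definition cond_entropy p i g : cube n -> R := fun x =>
  cond_exp p i (fun y => xlnx (g y)) x - xlnx (cond_exp p i g x).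

(** Averaging out one more coordinate i changes E (g ln (avg s g)) by the pairing of
g with the logarithm of a density on the two values of coordinate i, so the
duality above bounds the change by the entropy of g in that coordinate. *)
Lemma sub_avg_le_cond_entropy p (s : seq 'I_n) g : 0 < p -> p < 1 ->
  (forall x, 0 <= g x) ->
  expect p (fun x => xlnx (g x)) - expect p (fun x => g x * ln (avg p s g x))
  <= \sum_(i <- s) expect p (cond_entropy p i g).
Proof.
move=> p0 p1 g0; elim: s => [|i s IHs]; first by rewrite big_nil subrr.
rewrite big_cons /=; set P := avg p s g; rewrite -/P in IHs.
have P0 x : 0 <= P x by exact: avg_ge0.
have gP x : 0 < g x -> 0 < P x by exact: avg_gt0.
suff : expect p (fun x => g x * ln (P x))
     - expect p (fun x => g x * ln (cond_exp p i P x))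
     <= expect p (cond_entropy p i g) by lra.
rewrite -expectB -(expect_cond_exp p i); apply: le_expect => // x.
rewrite /cond_entropy {1}/cond_exp -!mulrBr !insensitive_cond_exp.
apply: two_point_entropy_dual => //; exact: gP.
Qed.

Lemma entropy_subadditive p g : 0 < p -> p < 1 -> (forall x, 0 <= g x) ->
  entropy p g <= \sum_i expect p (cond_entropy p i g).
Proof.
move=> p0 p1 g0; have := sub_avg_le_cond_entropy p (enum 'I_n) g p0 p1 g0.
rewrite big_enum /= /entropy; apply: le_trans; rewrite lerD2l lerN2.
under eq_expect do rewrite avg_enum mulrC.
by rewrite expectZ mulrC.
Qed.

(** Entropy tensorises: the entropy of f^2 in one coordinate is that of a function
on two points. *)
Lemma log_sobolev p f : 0 < p -> p < 1 ->
  entropy p (fun x => f x ^+ 2)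
  <= c_LS p * \sum_i expect p (fun x => lap p i f x ^+ 2).
Proof.
move=> p0 p1; apply: le_trans (entropy_subadditive p _ p0 p1 _) _.
  by move=> x; exact: sqr_ge0.
rewrite mulr_sumr; apply: ler_sum => i _.
rewrite expect_sqr_lap_diff mulrA -expectZ; apply: le_expect => // x.
exact: two_point_log_sobolev.
Qed.

(** Jensen gives the bound w ln (w / m^2), and the tangent at a of the convex
function w ln w makes it affine in w, so that it can be summed over martingale
differences. *)
Lemma entropy_sqr_ge p f (m : R) : 0 < p -> p < 1 -> 0 < m -> 
  expect p (fun x => `|f x|) <= m -> forall a w : R, 0 < a ->
  w = expect p (fun x => f x ^+ 2) ->
  (ln a - 2 * ln m + 1) * w - a <= entropy p (fun x => f x ^+ 2).
Proof.
move=> p0 p1 m0 fm a w a0 wE; pose E := expect p (fun x => xlnx (f x ^+ 2)).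
(* ln |f| >= ln l + 1 - l / |f|, multiplied by 2 f^2; the optimal l is w / m. *)
have key (l : R) : 0 < l -> 2 * ln l * w + 2 * w - 2 * l * m <= E.
  move=> l0; apply: le_trans (_ : expect p (fun x => 2 * ln l * f x ^+ 2
     + 2 * f x ^+ 2 - 2 * l * `|f x|) <= _).
    rewrite expectB expectD !expectZ -wE lerD2l lerN2 ler_wpM2l //.
    by rewrite mulr_ge0 // ltW.
  apply: le_expect => // x; rewrite -[f x ^+ 2]real_normK ?num_real //.
  have := normr_ge0 (f x); move: `|f x| => u.
  rewrite le0r => /predU1P[->|u0].
    by rewrite /xlnx expr0n /= !(mulr0, mul0r) addr0 subr0.
  have := ln_le_tangent l u l0 u0; rewrite /xlnx lnXn //.
  rewrite -(ler_pM2l (exprn_gt0 2 u0)).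
  have -> : u ^+ 2 * (ln u + l / u - 1) = u ^+ 2 * (ln u - 1) + u * l.
    by field; rewrite gt_eqF.
  lra.
have w0 : 0 <= w by rewrite wE; apply: expect_ge0 => // x; exact: sqr_ge0.
rewrite /entropy -/E -wE; move: w0; rewrite le0r => /predU1P[w_eq0|wp].
  rewrite w_eq0 /xlnx !mul0r subr0 mulr0.
  (* No optimal l exists here; this one makes the error 2 l m equal to a. *)
  have := key (a / (2 * m)); rewrite divr_gt0 ?mulr_gt0 // => /(_ isT).
  have -> : 2 * (a / (2 * m)) * m = a by field; rewrite gt_eqF.
  by rewrite w_eq0 !mulr0 addr0.
have := key (w / m); rewrite divr_gt0 // => /(_ isT).
have -> : 2 * (w / m) * m = 2 * w by field; rewrite gt_eqF.
rewrite ln_div ?posrE // => H.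
have := ln_le_tangent a w a0 wp; rewrite -(ler_pM2l wp).
have -> : w * (ln w + a / w - 1) = w * ln w + a - w by field; rewrite gt_eqF.
by rewrite /xlnx; lra.
Qed.

(** Each step of the averaging process contributes one martingale difference; both
the variance of f and the energies of the parts lap i f telescope along the
process, because averaging commutes with lap i. The natural choice of a is the
variance divided by n. *)
Lemma falik_samorodnitsky p f (m a : R) : 0 < p -> p < 1 -> 0 < m -> 0 < a ->
  (forall i, expect p (fun x => `|lap p i f x|) <= m) ->
  (ln a - 2 * ln m + 1)
    * (expect p (fun x => f x ^+ 2) - expect p f ^+ 2) - a * n%:R
  <= c_LS p * \sum_i expect p (fun x => lap p i f x ^+ 2).
Proof.
move=> p0 p1 m0 a0 fm.
pose S s := expect p (fun x => avg p s f x ^+ 2).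
pose D s := \sum_i expect p (fun x => avg p s (lap p i f) x ^+ 2).
have D0 s : 0 <= D s.
  by apply: sumr_ge0 => i _; apply: expect_ge0 => // x; exact: sqr_ge0.
have step s k : (ln a - 2 * ln m + 1) * (S s - S (k :: s)) - a
    <= c_LS p * (D s - D (k :: s)).
  have -> : S s - S (k :: s) = expect p (fun x => lap p k (avg p s f) x ^+ 2).
    by rewrite expect_sqr_lap.
  have Vm : expect p (fun x => `|lap p k (avg p s f) x|) <= m.
    rewrite -avg_lap; apply: le_trans (fm k); exact: expect_norm_avg.
  apply: le_trans (entropy_sqr_ge p _ m p0 p1 m0 Vm a _ a0 erefl) _.
  apply: le_trans (log_sobolev p _ p0 p1) _.
  rewrite le_eqVlt; apply/orP; left; apply/eqP; congr (_ * _).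
  rewrite /D -sumrB; apply: eq_bigr => i _.
  rewrite /= -expect_sqr_lap; apply: eq_expect => x.
  by rewrite avg_lap lapC.
have tele s : (ln a - 2 * ln m + 1) * (S [::] - S s) - a * (size s)%:R
    <= c_LS p * (D [::] - D s).
  elim: s => [|k s IHs]; first by rewrite !subrr !mulr0 subrr.
  by have := step s k; rewrite [size _]/= -natr1; lra.
have := tele (enum 'I_n); rewrite size_enum_ord.
have -> : S (enum 'I_n) = expect p f ^+ 2.
  by rewrite /S; under eq_expect do rewrite avg_enum; rewrite expect_cst.
move/le_trans; apply; rewrite ler_wpM2l //; last by rewrite lerBlDr lerDl D0.
by rewrite (le_trans ler01) // c_LS_ge1.
Qed.

End Entropy.

(** * Numerical bounds on the rate *)

(** From e^(-1/6) >= 5/6. *)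
Lemma expR1_le3 {R : realType} : expR 1 <= 3 :> R.
Proof.
have h : expR (6^-1) <= 6 / 5 :> R.
  have := expR_ge1Dx (- 6^-1 : R); rewrite expRN => h.
  rewrite -[X in X <= _]invrK -[leRHS]invrK.
  by rewrite lef_pV2 ?posrE ?invr_gt0 ?expR_gt0 //; lra.
have -> : 1 = 6^-1 * 6%:R :> R by rewrite mulVf ?pnatr_eq0.
rewrite expRM_natr; apply: le_trans (_ : (6 / 5) ^+ 6 <= _).
  by apply: lerXn2r => //; rewrite nnegrE; [exact: expR_ge0|lra].
lra.
Qed.

(** Split 2 = 6/5 * 5/4 * 4/3; the upper bound 2 ln r <= r - 1/r, that is,
x <= sinh x, sums to exactly 7/10. *)
Lemma ln2_bounds {R : realType} : (61 / 100 <= ln (2 : R)) && (ln (2 : R) <= 7 / 10).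
Proof.
have lo (x : R) : 0 < x -> 1 - x^-1 <= ln x.
  by move=> x0; have := ln_le_tangent 1 x ltr01 x0; rewrite ln1 div1r; lra.
have up (x : R) : 1 <= x -> ln x <= (x - x^-1) / 2.
  move=> x1; have x0 : 0 < x by apply: lt_le_trans x1.
  by have := ge_sinh (ln x) (ln_ge0 x1); rewrite /sinh expRN !lnK ?posrE.
have -> : ln (2 : R) = ln (6 / 5) + ln (5 / 4) + ln (4 / 3).
  by rewrite -!lnM ?posrE //; [congr ln; field|lra..].
have := lo (6 / 5); have := lo (5 / 4); have := lo (4 / 3).
have := up (6 / 5); have := up (5 / 4); have := up (4 / 3).
lra.
Qed.

Lemma s_rate_le_log {R : realType} (n : nat) :
  s_rate R n <= ln n%:R - 2 * ln (ln n%:R).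
Proof. by rewrite /s_rate lerD2l lerN2 le_max lexx orbT. Qed.

(** For n = 2 the first term of the maximum is the larger one; with
a = 4/e >= 4/3 the bound amounts to
2.86 + a + (3 + a) ln L >= (6 + a) ln 2, where L = ln (2 / (ln 2)^2). *)
Lemma s_rate2_le {R : realType} : s_rate R 2 <= 86 / 100.
Proof.
have /andP[lo up] := @ln2_bounds R.
have l70 : ln (7 / 10 : R) <= - (42 / 125).
  have -> : 7 / 10 = 9 / 10 * (8 / 9) * (7 / 8) :> R by field.
  rewrite lnM ?posrE; [rewrite lnM ?posrE; [|lra..]|lra..].
  have := ln_le_tangent (9 / 10 : R) 1; have := ln_le_tangent (8 / 9 : R) 1.
  have := ln_le_tangent (7 / 8 : R) 1; rewrite ln1; lra.
have ll2 : ln (ln (2 : R)) <= - (42 / 125).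
  by apply: le_trans l70; rewrite ler_ln ?posrE //; lra.
set e : R := expR 1; pose a := 4 / e; have e0 : 0 < e by exact: expR_gt0.
have a3 : 4 / 3 <= a by rewrite /a ler_pM2l // lef_pV2 ?posrE // expR1_le3.
pose L : R := ln (2 / ln 2 ^+ 2).
have LE : L = ln 2 - 2 * ln (ln 2).
  have l0 : 0 < ln (2 : R) by lra.
  rewrite /L ln_div ?posrE ?exprn_gt0 // lnXn //; ring.
have L1 : 32 / 25 <= L by lra.
have L0 : 0 < L by lra.
have lL : 7 / 32 <= ln L.
  have := ln_le_tangent (32 / 25) L; have := ln_le_tangent 1 (32 / 25 : R).
  have : ln (32 / 25) <= ln L by rewrite ler_ln ?posrE //; lra.
  rewrite ln1; lra.
rewrite /s_rate -/e -/a -/L lerBlDr -lerBlDl le_max; apply/orP; left.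
have pp (x y : R) : 0 < x -> 0 < x `^ y by exact: powR_gt0.
rewrite lnM ?posrE ?divr_gt0 ?pp // ln_div ?posrE ?pp // !ln_powR expRK mulr1.
have : (5 + a) * ln 2 <= (5 + a) * (7 / 10) by rewrite ler_wpM2l //; lra.
have : (3 + a) * (7 / 32) <= (3 + a) * ln L by rewrite ler_wpM2l //; lra.
lra.
Qed.

(** If t < ln n - 2 ln ln n and ln n >= 1, then t < ln n, so
t + 2 ln t < ln n. For n = 2 the hypothesis forces t >= 0.86, since
0.86 + 2 ln 0.86 < 0.61. *)
Lemma s_rate_le {R : realType} (n : nat) (t : R) : (2 <= n)%N -> 0 < t ->
  ln n%:R <= t + 2 * ln t -> s_rate R n <= t.
Proof.
move=> n2 t0 tn; rewrite leNgt; apply/negP => ts.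
have := n2; rewrite leq_eqVlt => /predU1P[nE|n3].
  rewrite -nE in ts tn; have t86 := lt_le_trans ts s_rate2_le.
  have /andP[lo _] := @ln2_bounds R.
  have : ln t <= ln (86 / 100) by rewrite ler_ln ?posrE //; lra.
  have := ln_le_tangent (86 / 100 : R) 1; rewrite ln1; lra.
have ln3 : 1 <= ln (n%:R : R).
  rewrite -[X in X <= _]expRK ler_ln ?posrE ?expR_gt0 ?ltr0n ?(ltnW n2) //.
  by apply: le_trans expR1_le3 _; rewrite ler_nat.
have ts' := lt_le_trans ts (s_rate_le_log n).
have := ln_ge0 ln3 => lln.
have : ln t < ln (ln n%:R) by rewrite ltr_ln ?posrE; lra.
lra.
Qed.

(** * Influences and symmetry *)

Section Influence.
Context {R : realType} {n : nat}.
Implicit Types (p : R) (i j : 'I_n) (x : cube n) (A : {set cube n}).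

Definition indic A : cube n -> R := fun x => (x \in A)%:R.

(** For monotone A this is the indicator that coordinate i is pivotal. *)
Definition pivotal A i : cube n -> R := fun x =>
  indic A (set_coord i true x) - indic A (set_coord i false x).

Definition influence p A i : R := expect p (pivotal A i).

Lemma derive_weight p x : 0 < p -> p < 1 ->
  (('X^(\sum_(i < n) x i)%N * (1 - 'X) ^+ (\sum_(i < n) (1 - x i))%N)^`()).[p]
  = weight p x * \sum_i (if x i then p^-1 else - (1 - p)^-1).
Proof.
move=> p0 p1; have q0 : 0 < 1 - p by rewrite subr_gt0.
have -> : \sum_i (if x i then p^-1 else - (1 - p)^-1)
    = (\sum_(i < n) x i)%:R / p - (\sum_(i < n) (1 - x i))%:R / (1 - p).
  rewrite !natr_sum !mulr_suml -sumrB; apply: eq_bigr => i _.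
  by case: (x i); rewrite /= !(mul1r, mul0r, subr0, sub0r).
rewrite /weight; move: (\sum_(i < n) x i)%N (\sum_(i < n) (1 - x i))%N => a b.
have Xn (y : R) k : 0 < y -> k%:R * y ^+ k.-1 = y ^+ k * (k%:R / y).
  case: k => [|k] y0; first by rewrite !mul0r mulr0.
  by rewrite /= exprS; field; rewrite gt_eqF.
rewrite derivM derivXn deriv_exp derivB derivC derivX sub0r.
rewrite !(hornerD, hornerM, hornerMn, horner_exp).
rewrite !(hornerD, hornerN, hornerX, hornerXn, hornerC).
rewrite -[p ^+ a.-1 *+ a]mulr_natl -[_ *+ b]mulr_natl Xn //.
have := Xn _ b q0; move: ((1 - p) ^+ b.-1) => u H.
transitivity (p ^+ a * (a%:R / p) * (1 - p) ^+ b - p ^+ a * (b%:R * u)).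
  by ring.
by rewrite H; ring.
Qed.

(** The derivative of the weight is the weight times a sum of scores, one for each
coordinate; the average over x_i of the indicator times the i-th score is the
difference of its values at x_i = 1 and x_i = 0. *)
Lemma russo p A : 0 < p -> p < 1 ->
  derive1 (fun q : R => bernoulli_measure q A) p = \sum_i influence p A i.
Proof.
move=> p0 p1.
pose P : {poly R} := \sum_(x in A)
  'X^(\sum_(i < n) x i)%N * (1 - 'X) ^+ (\sum_(i < n) (1 - x i))%N.
have -> : (fun q : R => bernoulli_measure q A) = (fun q : R => P.[q]).
  apply/funext => q; rewrite /P horner_sum; apply: eq_bigr => x _.
  by rewrite !hornerE.
have [_ H] := is_derive_poly P p; rewrite derive1E H {H}.
rewrite /P raddf_sum horner_sum.
transitivity (\sum_x weight p x *
    (indic A x * \sum_i (if x i then p^-1 else - (1 - p)^-1))).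
  rewrite big_mkcond; apply: eq_bigr => x _; rewrite /indic.
  by case: (x \in A); rewrite ?derive_weight // ?mul1r ?mul0r ?mulr0.
under eq_bigr do rewrite !mulr_sumr.
rewrite exchange_big; apply: eq_bigr => i _ /=.
pose score x := indic A x * (if x i then p^-1 else - (1 - p)^-1).
rewrite -[LHS]/(expect p score) -(expect_cond_exp p i); apply: eq_expect => x.
rewrite /cond_exp /score /pivotal !ffunE eqxx; field.
by rewrite !gt_eqF ?subr_gt0.
Qed.

Lemma indic_le A i x : monotone_set A ->
  indic A (set_coord i false x) <= indic A (set_coord i true x).
Proof.
move=> mA; rewrite /indic.
case: (boolP (set_coord i false x \in A)) => [H|_]; last exact: ler0n.
rewrite (mA _ _ H) // => j; rewrite !ffunE; case: eqP => //.
Qed.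

Lemma expect_sqr_lap_indic p A i : monotone_set A ->
  expect p (fun x => lap p i (indic A) x ^+ 2) = p * (1 - p) * influence p A i.
Proof.
move=> mA; rewrite expect_sqr_lap_diff; congr (_ * _); apply: eq_expect => x.
have := indic_le A i x mA; rewrite /pivotal /indic.
by do 2 case: (_ \in A); rewrite /= ?mulr1n ?mulr0n ?ler10 // => _; ring.
Qed.

Lemma expect_norm_lap_indic p A i : 0 < p -> p < 1 -> monotone_set A ->
  expect p (fun x => `|lap p i (indic A) x|) = 2 * (p * (1 - p) * influence p A i).
Proof.
move=> p0 p1 mA; have q0 : 0 < 1 - p by rewrite subr_gt0.
rewrite -(expect_cond_exp p i) mulrA /influence -expectZ; apply: eq_expect => x.
have d0 : 0 <= pivotal A i x by rewrite subr_ge0 indic_le.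
rewrite /cond_exp /lap !insensitive_cond_exp.
have -> : indic A (set_coord i false x) - cond_exp p i (indic A) x
    = - (p * pivotal A i x).
  by rewrite /cond_exp /pivotal; ring.
have -> : indic A (set_coord i true x) - cond_exp p i (indic A) x
    = (1 - p) * pivotal A i x.
  by rewrite /cond_exp /pivotal; ring.
by rewrite normrN !ger0_norm ?mulr_ge0 ?(ltW p0) ?(ltW q0) //; ring.
Qed.

Lemma perm_cube_set_coord (s : 'S_n) i b x :
  set_coord (s i) b (perm_cube s x) = perm_cube s (set_coord i b x).
Proof.
apply/ffunP => j; rewrite !ffunE; congr (if _ then _ else _).
by rewrite -[RHS](inj_eq (@perm_inj _ s)) permKV.
Qed.

Lemma weight_perm_cube p (s : 'S_n) x : weight p (perm_cube s x) = weight p x.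
Proof.
rewrite !weightE (reindex_inj (@perm_inj _ s)) /=; apply: eq_bigr => i _.
by rewrite ffunE permK.
Qed.

Lemma perm_cubeK (s : 'S_n) : cancel (@perm_cube n s) (perm_cube (s^-1)%g).
Proof. by move=> x; apply/ffunP => i; rewrite !ffunE invgK permK. Qed.

Lemma influence_perm p A (s : 'S_n) i :
  (forall x, (perm_cube s x \in A) = (x \in A)) ->
  influence p A (s i) = influence p A i.
Proof.
move=> sA; rewrite /influence /expect (reindex_inj (can_inj (perm_cubeK s))) /=.
apply: eq_bigr => x _; rewrite weight_perm_cube /pivotal /indic.
by rewrite !perm_cube_set_coord !sA.
Qed.

Lemma influence_symmetric p A i j : symmetric_set A ->
  influence p A i = influence p A j.
Proof.
case=> G [trG GA].
have [s sG ->] := atransP2 trG (finset.in_setT j) (finset.in_setT i).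
rewrite [in RHS]/= /aperm influence_perm // => x; apply/idP/idP; last exact: GA.
by rewrite -{2}(perm_cubeK s x); apply: GA; rewrite groupV.
Qed.

End Influence.

Lemma expect_indic_gt0 {R : realType} {n : nat} (p : R) (A : {set cube n}) x :
  0 < p -> p < 1 -> x \in A -> 0 < expect p (indic A).
Proof.
move=> p0 p1 xA; rewrite /expect (bigD1 x) //= /indic xA mulr1.
rewrite ltr_pwDl ?weight_gt0 // sumr_ge0 // => y _.
by rewrite mulr_ge0 ?ler0n // ltW // weight_gt0.
Qed.

Lemma bernoulli_measure_bounds {R : realType} {n : nat} (p : R) (A : {set cube n}) :
  0 < p -> p < 1 -> nontrivial_set A ->
  0 < bernoulli_measure p A /\ bernoulli_measure p A < 1.
Proof.
move=> p0 p1 [A0 AT]; rewrite bernoulli_measureE -/(indic A); split.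
  have [E|[x xA]] := set_0Vmem A; first by [].
  exact: expect_indic_gt0 xA.
have [E|[x xA]] := set_0Vmem (~: A)%SET.
  by case: AT; rewrite -[A]finset.setCK E finset.setC0.
rewrite -subr_gt0 -(expect_cst (n := n) p 1) -expectB.
rewrite (eq_expect _ _ (indic (~: A)%SET)); first exact: expect_indic_gt0 xA.
by move=> y; rewrite /indic finset.in_setC; case: (y \in A); rewrite ?subrr ?subr0.
Qed.

(** * The threshold inequality *)

Theorem theorem4p1 (R : realType) (n : nat) (hn : (2 <= n)%N) (p : R)
    (hp0 : 0 < p) (hp1 : p < 1) (A : {set cube n}) :
  nontrivial_set A -> monotone_set A -> symmetric_set A ->
  s_rate R n / (p * (1 - p) * c_LS p)
    * bernoulli_measure p A * (1 - bernoulli_measure p A)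
  <= derive1 (fun q : R => bernoulli_measure q A) p.
Proof.
move=> ntA mA sA; rewrite russo //.
have [mu0 mu1] := bernoulli_measure_bounds p A hp0 hp1 ntA.
have muE : expect p (indic A) = bernoulli_measure p A by rewrite bernoulli_measureE.
set mu := bernoulli_measure p A in mu0 mu1 muE *.
have q0 : 0 < 1 - p by rewrite subr_gt0.
pose I := \sum_i influence p A i; rewrite -/I.
pose c := c_LS p; have c1 : 1 <= c by exact: c_LS_ge1.
have c0 : 0 < c by exact: lt_le_trans c1.
pose W := mu * (1 - mu).
have W0 : 0 < W by rewrite mulr_gt0 ?subr_gt0.
have N0 : 0 < n%:R :> R by rewrite ltr0n (ltn_trans _ hn).
pose X := p * (1 - p) * I.
have infE i : influence p A i = I / n%:R.
  rewrite /I (eq_bigr (fun=> influence p A i)) => [|j _]; last first.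
    exact: influence_symmetric.
  by rewrite sumr_const card_ord -[_ *+ n in RHS]mulr_natr mulfK // gt_eqF.
have I0 : 0 <= I.
  by apply: sumr_ge0 => i _; apply: expect_ge0 => // x; rewrite subr_ge0 indic_le.
have X0 : 0 <= X by rewrite !mulr_ge0 // ltW.
have main (m a : R) : 0 < m -> 0 < a -> 2 * X / n%:R <= m ->
    (ln a - 2 * ln m + 1) * W - a * n%:R <= c * X.
  move=> m0 a0 Xm; have := falik_samorodnitsky p (indic A) m a hp0 hp1 m0 a0.
  have -> : expect p (fun x => indic A x ^+ 2) = mu.
    rewrite -muE; apply: eq_expect => x.
    by rewrite /indic; case: (x \in A); rewrite ?expr1n ?expr0n.
  under eq_bigr do rewrite expect_sqr_lap_indic //.
  rewrite -mulr_sumr muE -/I -/X.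
  have -> : mu - mu ^+ 2 = W by rewrite /W; ring.
  apply=> i; rewrite expect_norm_lap_indic // infE; apply: le_trans Xm.
  by rewrite /X !mulrA.
have [XE WE] : X = p * (1 - p) * I /\ W = mu * (1 - mu) by [].
clearbody X W.
(* If X were 0, the martingale differences would vanish in L1; taking m small
   enough contradicts W > 0. *)
have Xp : 0 < X.
  rewrite lt_def X0 andbT; apply/negP => /eqP X_0.
  have := main (expR (- (n%:R / W))) 1 (expR_gt0 _) ltr01.
  rewrite X_0 !mulr0 mul0r expR_ge0 ln1 expRK => /(_ isT).
  have -> : (0 - 2 * - (n%:R / W) + 1) * W - 1 * n%:R = n%:R + W.
    by field; rewrite gt_eqF.
  by rewrite leNgt addr_gt0.
pose t := c * (X / W).
have t0 : 0 < t by rewrite mulr_gt0 // divr_gt0.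
have st : s_rate R n <= t.
  apply: s_rate_le => //.
  have m0 : 0 < 2 * X / n%:R by apply: divr_gt0 N0; exact: mulr_gt0.
  have := main _ (W / n%:R) m0 (divr_gt0 W0 N0) (lexx _).
  rewrite divfK ?gt_eqF // !ln_div ?posrE ?mulr_gt0 // lnM ?posrE //.
  have -> : c * X = t * W by rewrite /t; field; rewrite gt_eqF.
  rewrite -[X in _ - X]mul1r -mulrBl ler_pM2r // addrK => H.
  (* The variance of an indicator is at most 1/4. *)
  have W4 : ln W <= - (2 * ln 2).
    have -> : - (2 * ln (2 : R)) = ln (4^-1).
      rewrite lnV ?posrE //; have -> : 4 = 2 ^+ 2 :> R by ring.
      by rewrite lnXn //; ring.
    rewrite ler_ln ?posrE ?invr_gt0 //.
    have -> : W = 4^-1 - (mu - 2^-1) ^+ 2 by rewrite WE; field.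
    by rewrite gerBl sqr_ge0.
  have lt : ln t = ln c + (ln X - ln W).
    by rewrite /t lnM ?posrE ?divr_gt0 // ln_div ?posrE.
  have := ln_ge0 c1; lra.
rewrite -mulrA -WE mulrAC ler_pdivrMr ?mulr_gt0 //.
have -> : I * (p * (1 - p) * c_LS p) = t * W.
  by rewrite /t XE -/c; field; rewrite gt_eqF.
by rewrite ler_pM2r.
Qed.
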